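(* Let $\Omega$ be an atomless Borel probability space with measure $\nu$, let $k\ge 1$ be a natural number, and let $W:\Omega^2\to[0,1]$ be a graphon such that $t(H,W)=0$ for each finite graph $H$ of chromatic number $k+1$. Then $W$ is $k$-partite.
   Context: A graphon is a symmetric measurable function $W:\Omega^2\to[0,1]$. For a finite simple graph $F$ on vertex set $\{1,\dots,m\}$, its density in $W$ is $t(F,W)=\int_{\Omega^m}\prod_{ij\in E(F),\,i<j}W(x_i,x_j)\,d\nu^{\otimes m}(x_1,\dots,x_m)$. A measurable set $A\subseteq\Omega$ is independent in $W$ if $W=0$ almost everywhere on $A\times A$. $W$ is $k$-partite if there is a partition $\Omega=\Omega_1\sqcup\dots\sqcup\Omega_k$ into measurable sets (possibly empty or null), each independent in $W$. *)

(* Defs.v *)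
From HB Require Import structures.
From mathcomp Require Import all_boot all_order all_algebra.
From mathcomp Require Import all_classical all_reals all_analysis.

Set Implicit Arguments.
Unset Strict Implicit.
Unset Printing Implicit Defensive.

Import Order.TTheory GRing.Theory Num.Theory.
Import numFieldNormedType.Exports.

Local Open Scope classical_set_scope.
Local Open Scope ring_scope.

(* The sigma-algebra of [T] is the Borel sigma-algebra of a Polish space
   transported along a bijection.  A Hausdorff pseudometric is a metric, so [P]
   is a complete separable metric space. *)
Definition standard_borel (R : realType) (d : measure_display)
    (T : measurableType d) : Prop :=
  exists (P : completePseudoMetricType R) (f : T -> P),
    [/\ hausdorff_space P,
        exists2 D : set P, countable D & dense D,
        bijective f &
        @measurable d T = preimage_set_system setT f <<s @open P >>].

Definition is_atom (R : realType) (d : measure_display) (T : measurableType d)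
    (nu : probability T R) (A : set T) : Prop :=
  [/\ measurable A, (0 < nu A)%E &
      forall B : set T, measurable B -> B `<=` A ->
        nu B = 0%E \/ nu B = nu A].

Definition atomless (R : realType) (d : measure_display) (T : measurableType d)
    (nu : probability T R) : Prop :=
  forall A : set T, ~ is_atom nu A.

Definition cons_pair (T : Type) (n : nat) (x : T * n.-tuple T) : n.+1.-tuple T :=
  [tuple of x.1 :: x.2].

Lemma measurable_cons_pair (d : measure_display) (T : measurableType d)
    (n : nat) : measurable_fun setT (@cons_pair T n).
Proof. exact: (@measurable_cons _ _ _ _ fst n snd). Qed.

HB.instance Definition _ (d : measure_display) (T : measurableType d)
    (n : nat) :=
  isMeasurableFun.Build _ _ _ _ (@cons_pair T n) (@measurable_cons_pair d T n).

(* The product measure on [T ^ n]: each step is the image of the binary product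
   [nu \x nu ^ n] under the canonical bijection [T * T ^ n -> T ^ n.+1]. *)
Fixpoint power_prob (R : realType) (d : measure_display) (T : measurableType d)
    (nu : probability T R) (n : nat) : probability (n.-tuple T) R :=
  match n return probability (n.-tuple T) R with
  | 0 => dirac ([tuple] : 0.-tuple T)
  | p.+1 => distribution (nu \x power_prob nu p)%E (@cons_pair T p)
  end.

Lemma measurable_rect (d : measure_display) (T : measurableType d) (n : nat)
    (A : 'I_n -> set T) :
  (forall i, measurable (A i)) ->
  measurable [set x : n.-tuple T | forall i, A i (tnth x i)].
Proof.
move=> mA.
have -> : [set x : n.-tuple T | forall i, A i (tnth x i)] =
    \bigcap_(i in [set: 'I_n]) ((@tnth n T ^~ i) @^-1` A i).
  by apply/seteqP; split => x /= Ax i; [move=> _; exact: Ax | exact: Ax].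
apply: fin_bigcap_measurable; first exact: finite_finset.
move=> i _; rewrite -[X in measurable X]setTI.
exact: measurable_tnth.
Qed.

Lemma power_prob_rect (R : realType) (d : measure_display)
    (T : measurableType d) (nu : probability T R) (n : nat)
    (A : 'I_n -> set T) :
  (forall i, measurable (A i)) ->
  power_prob nu n [set x | forall i, A i (tnth x i)] =
    (\prod_(i < n) nu (A i))%E.
Proof.
elim: n A => [|n IHn] A mA.
  rewrite big_ord0 /=.
  have -> : [set x : 0.-tuple T | forall i, A i (tnth x i)] = setT.
    by apply/seteqP; split => // x _ [].
  by rewrite diracT.
rewrite big_ord_recl /= /distribution /pushforward.
have -> : (@cons_pair T n) @^-1` [set x | forall i, A i (tnth x i)] =
    A ord0 `*` [set x | forall i, A (lift ord0 i) (tnth x i)].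
  apply/seteqP; split => [[a x] /= Ax|[a x] /= [Aa Ax] i].
    split; first exact: (Ax ord0).
    by move=> i; have := Ax (lift ord0 i); rewrite /cons_pair tnthS.
  by case: (unliftP ord0 i) => [j|] ->; rewrite /cons_pair ?tnthS ?tnth0.
pose B (i : 'I_n) := A (lift ord0 i).
have mB i : measurable (B i) by exact: mA.
rewrite product_measure1E //; last exact: (measurable_rect mB).
by congr (_ * _)%E; exact: (IHn B mB).
Qed.

Definition is_graphon (R : realType) (d : measure_display)
    (T : measurableType d) (W : T * T -> R) : Prop :=
  [/\ measurable_fun setT W,
      forall x y, W (x, y) = W (y, x) &
      forall z, 0 <= W z <= 1].

Record simple_graph (m : nat) := SimpleGraph {
  adj : rel 'I_m;
  adj_sym : symmetric adj;
  adj_irrefl : irreflexive adj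
}.

Definition colorable (m : nat) (H : simple_graph m) (n : nat) : bool :=
  [exists c : {ffun 'I_m -> 'I_n},
    [forall i, forall j, adj H i j ==> (c i != c j)]].

Lemma colorable_vertices (m : nat) (H : simple_graph m) :
  exists n, colorable H n.
Proof.
exists m; apply/existsP; exists [ffun i => i].
apply/forallP => i; apply/forallP => j; apply/implyP => Hij.
by rewrite !ffunE; apply: contraTneq Hij => ->; rewrite adj_irrefl.
Qed.

Definition chromatic_number (m : nat) (H : simple_graph m) : nat :=
  ex_minn (colorable_vertices H).

Definition density (R : realType) (d : measure_display) (T : measurableType d)
    (nu : probability T R) (m : nat) (F : simple_graph m) (W : T * T -> R) :
    \bar R :=
  (\int[power_prob nu m]_x
    (\prod_(e : 'I_m * 'I_m | (e.1 < e.2)%N && adj F e.1 e.2)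
       W (tnth x e.1, tnth x e.2))%:E)%E.

Definition independent_in (R : realType) (d : measure_display)
    (T : measurableType d) (nu : probability T R) (W : T * T -> R)
    (A : set T) : Prop :=
  measurable A /\ {ae (nu \x nu)%E, forall z, (A `*` A) z -> W z = 0}.

Definition partite (R : realType) (d : measure_display) (T : measurableType d)
    (nu : probability T R) (k : nat) (W : T * T -> R) : Prop :=
  exists P : 'I_k -> set T,
    [/\ trivIset setT P, \bigcup_i P i = setT &
        forall i, independent_in nu W (P i)].

(* Main.v *)
Require Import Defs.
From HB Require Import structures.
From mathcomp Require Import all_boot all_order all_algebra.
From mathcomp Require Import all_classical all_reals all_analysis.
From mathcomp Require Import measurable_realfun lra.

Set Implicit Arguments.
Unset Strict Implicit.
Unset Printing Implicit Defensive.

Import Order.TTheory GRing.Theory Num.Theory.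
Import numFieldNormedType.Exports.

Local Open Scope classical_set_scope.
Local Open Scope ring_scope.

(* Almost every finite sample from the graph E = {W != 0} is k-colorable, since
   a graph that is not k-colorable contains one of chromatic number k + 1.
   Approximate E in measure by a union F of products of cells of a finite
   partition, and color a sample having many points in each cell and few
   disagreements between E and F.  The color classes give measures
   theta_1, ..., theta_k with sum nu, and (theta_i x theta_i)(E) is small.  Let
   mu_i be the limit of theta_i along an ultrafilter, as the error tends to 0.
   Being dominated by nu, it is countably additive; so is the limit of
   theta_i x theta_i, which agrees with mu_i x mu_i on rectangles, hence
   everywhere, so that (mu_i x mu_i)(E) = 0.  The supports of the densities of
   mu_1, ..., mu_k with respect to nu are then independent and cover Omega up to
   a null set. *)

(** * Colorings and subgraphs of chromatic number [k + 1] *)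

Lemma colorableP (m : nat) (H : simple_graph m) (n : nat) :
  reflect (exists c : 'I_m -> 'I_n, forall i j, adj H i j -> c i != c j)
          (colorable H n).
Proof.
apply: (iffP existsP) => -[c cP].
  by exists c => i j; move/forallP/(_ i)/forallP/(_ j)/implyP : cP.
exists [ffun i => c i]; apply/forallP => i; apply/forallP => j.
by apply/implyP => /cP; rewrite !ffunE.
Qed.

Lemma colorable_leq (m : nat) (H : simple_graph m) (n p : nat) :
  (n <= p)%N -> colorable H n -> colorable H p.
Proof.
move=> np /colorableP[c cP]; apply/colorableP.
exists (fun i => widen_ord np (c i)) => i j /cP.
by apply: contra_neq => /(congr1 val) /= ?; exact: val_inj.
Qed.

Lemma chromatic_number_eq (m : nat) (H : simple_graph m) (n : nat) :
  ~~ colorable H n -> colorable H n.+1 -> chromatic_number H = n.+1.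
Proof.
move=> Hn HSn; rewrite /chromatic_number; case: ex_minnP => p Hp minp.
apply/eqP; rewrite eqn_leq minp//= ltnNge.
by apply: contra Hn => /colorable_leq; exact.
Qed.

Section delete_edge.
Variables (m : nat) (H : simple_graph m) (u v : 'I_m).

Definition delete_edge_adj : rel 'I_m := fun i j =>
  [&& adj H i j, (i, j) != (u, v) & (i, j) != (v, u)].

Lemma delete_edge_sym : symmetric delete_edge_adj.
Proof.
move=> i j; rewrite /delete_edge_adj adj_sym !xpair_eqE; congr (_ && _).
by rewrite (andbC (j == u)) (andbC (j == v)) andbC.
Qed.

Lemma delete_edge_irrefl : irreflexive delete_edge_adj.
Proof. by move=> i; rewrite /delete_edge_adj adj_irrefl. Qed.

Definition delete_edge := SimpleGraph delete_edge_sym delete_edge_irrefl.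

(** A fresh color on [u] suffices: the deleted edge has [u] as an endpoint, and the other vertices
    keep their colors. *)
Lemma colorable_delete_edge (n : nat) :
  colorable delete_edge n -> colorable H n.+1.
Proof.
move=> /colorableP[c cP]; apply/colorableP.
exists (fun i => if i == u then ord_max else widen_ord (leqnSn n) (c i)).
have lt_max (a : 'I_n) : (a < n)%N by [].
have neq_max a : widen_ord (leqnSn n) a != ord_max.
  by rewrite -val_eqE /= neq_ltn lt_max.
move=> i j Hij; case: (eqVneq i u) => [iu|iu].
  case: (eqVneq j u) => [ju|ju]; last by rewrite eq_sym.
  by move: Hij; rewrite iu ju adj_irrefl.
case: (eqVneq j u) => [ju|ju]//.
apply: contra_neq (cP i j _) => [/(congr1 val) /= ?|]; first exact: val_inj.
by rewrite /= /delete_edge_adj Hij !xpair_eqE (negbTE iu) (negbTE ju) andbF.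
Qed.

End delete_edge.

(** Edges are deleted one by one while the graph stays not [k]-colorable. This must stop, since for
    [k > 0] an edgeless graph is [k]-colorable. When the next deletion would give a [k]-colorable
    graph, the current one has chromatic number [k + 1], because restoring an edge costs at most one
    color. *)
Lemma critical_subgraph (m : nat) (H : simple_graph m) (k : nat) :
  (0 < k)%N -> ~~ colorable H k ->
  exists H' : simple_graph m,
    (forall i j, adj H' i j -> adj H i j) /\ chromatic_number H' = k.+1.
Proof.
move=> k0; have [n] := ubnP #|[pred e : 'I_m * 'I_m | adj H e.1 e.2]|.
elim: n H => // n IHn H ltHn nHk.
have [/existsP[[u v] /= Huv]|/existsPn noedge] :=
    boolP [exists e : 'I_m * 'I_m, adj H e.1 e.2]; last first.
  case/negP: nHk; apply/colorableP; exists (fun=> Ordinal k0) => i j Hij.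
  by have := noedge (i, j); rewrite Hij.
have [Dk|nDk] := boolP (colorable (delete_edge H u v) k).
  by exists H; split=> //; apply: chromatic_number_eq (colorable_delete_edge Dk).
have [|H' [H'D H'k]] := IHn (delete_edge H u v) _ nDk.
  rewrite -ltnS (leq_trans _ ltHn)// ltnS; apply: proper_card.
  apply/properP; split.
    by apply/fintype.subsetP => e; rewrite !inE => /and3P[].
  by exists (u, v); rewrite ?inE//= /delete_edge_adj eqxx /= andbF.
by exists H'; split=> // i j /H'D /and3P[].
Qed.

(** * The graph sampled from [W] at a random tuple *)

Section sample_graph.
Context (R : realType) (d : measure_display) (T : measurableType d).
Variables (W : T * T -> R) (hW : is_graphon W).

Definition sample_adj (m : nat) (x : m.-tuple T) : rel 'I_m := fun i j =>
  (i != j) && (W (tnth x i, tnth x j) != 0).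

Lemma sample_adj_sym m (x : m.-tuple T) : symmetric (sample_adj x).
Proof. by move=> i j; case: hW => _ Wsym _; rewrite /sample_adj eq_sym Wsym. Qed.

Lemma sample_adj_irrefl m (x : m.-tuple T) : irreflexive (sample_adj x).
Proof. by move=> i; rewrite /sample_adj eqxx. Qed.

Definition sample_graph m (x : m.-tuple T) :=
  SimpleGraph (sample_adj_sym x) (sample_adj_irrefl x).

(** Zero density means that the product of [W] over the edges of [H] vanishes almost everywhere, so
    almost surely the sample graph does not contain [H] on the same labeled vertices. This holds
    simultaneously for the finitely many [H] of chromatic number [k + 1] on [m] vertices, and
    [critical_subgraph] concludes. *)
Lemma ae_sample_colorable (nu : probability T R) (k m : nat) : (0 < k)%N ->
  (forall (m : nat) (H : simple_graph m),
      chromatic_number H = k.+1 -> density nu H W = 0%E) ->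
  {ae power_prob nu m, forall x, colorable (sample_graph x) k}.
Proof.
move=> k0 hH; case: (hW) => mW Wsym W01.
(* Graphs are indexed by their adjacency tables [g], which form a finite type, so that
   [filter_forall] can unite the null sets. *)
have ae_g (g : {ffun 'I_m * 'I_m -> bool}) : {ae power_prob nu m, forall x,
    forall H : simple_graph m, chromatic_number H = k.+1 ->
      (forall i j, adj H i j = g (i, j)) ->
      ~ (forall i j, adj H i j -> sample_adj x i j)}.
  have [[H [Hk Hg]]|noH] := pselect (exists H : simple_graph m,
      chromatic_number H = k.+1 /\ forall i j, adj H i j = g (i, j)); last first.
    by apply: aeW => x H Hk Hg; exfalso; apply: noH; exists H.
  pose f (x : m.-tuple T) : R :=
    \prod_(e : 'I_m * 'I_m | (e.1 < e.2)%N && adj H e.1 e.2)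
      W (tnth x e.1, tnth x e.2).
  have mf : measurable_fun setT f.
    rewrite /f; under eq_fun do rewrite -big_filter.
    apply: measurable_prod => e _.
    apply: measurableT_comp => //.
    by apply/measurable_fun_pairP; split; exact: measurable_tnth.
  have f0 x : 0 <= f x.
    by apply: prodr_ge0 => e _; case/andP: (W01 (tnth x e.1, tnth x e.2)).
  have : ae_eq (power_prob nu m) setT (EFin \o f) (cst 0%E).
    apply/ae_eq_integral_abs => //; first exact/measurable_EFinP.
    rewrite -[RHS](hH _ _ Hk); apply: eq_integral => x _ /=.
    by rewrite ger0_norm.
  apply: filterS => x /= /(_ Logic.I) [fx0] H' _ H'g H'x.
  have : f x != 0.
    apply/prodf_neq0 => e /andP[_ He].
    have /H'x /andP[]// : adj H' e.1 e.2 by rewrite H'g -Hg.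
  by rewrite fx0 eqxx.
have : {ae power_prob nu m, forall x, forall g : {ffun 'I_m * 'I_m -> bool},
    forall H : simple_graph m, chromatic_number H = k.+1 ->
      (forall i j, adj H i j = g (i, j)) ->
      ~ (forall i j, adj H i j -> sample_adj x i j)}.
  exact: filter_forall.
apply: filterS => x xP; have [//|] := boolP (colorable (sample_graph x) k).
move=> /(critical_subgraph k0)[H [HW Hk]]; exfalso.
by apply: (xP [ffun e => adj H e.1 e.2] H Hk) => [i j|]//; rewrite ffunE.
Qed.

End sample_graph.

(** * Approximation in measure by unions of products of cells *)

Lemma cvg_measure_tail (R : realType) (d : measure_display)
    (T : measurableType d) (P : {finite_measure set T -> \bar R})
    (F : (set T)^nat) :
  (forall i, measurable (F i)) -> trivIset setT F ->
  P (\bigcup_i F i `\` \big[setU/set0]_(i < n) F i) @[n --> \oo] --> 0%E.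
Proof.
move=> mF tF; have mU : measurable (\bigcup_i F i) by exact: bigcup_measurable.
have mUn n : measurable (\big[setU/set0]_(i < n) F i).
  exact: bigsetU_measurable.
rewrite [X in X @ _ --> _](_ : _ =
    fun n => P (\bigcup_i F i) - \sum_(0 <= i < n) P (F i))%E; last first.
  apply/funext => n; rewrite big_mkord -measure_bigsetU//.
  rewrite measureD ?ltey_eq ?fin_num_measure// setIidr//.
  exact: bigsetU_bigcup.
rewrite -[X in _ --> X](@subee _ (P (\bigcup_i F i))) ?fin_num_measure//.
apply: cvgeB; [|exact: cvg_cst|exact: measure_semi_sigma_additive].
by rewrite fin_num_adde_defr// fin_num_measure.
Qed.

Lemma measurable_support (R : realType) (d : measure_display)
    (T : measurableType d) (f : T -> R) :
  measurable_fun setT f -> measurable [set x | f x != 0].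
Proof.
move=> mf; rewrite [X in measurable X](_ : _ = f @^-1` (~` [set 0])).
  by rewrite -[X in measurable X]setTI; apply: mf => //; exact: measurableC.
by apply/seteqP; split => x /= /eqP.
Qed.

Lemma measurable_setY (d : measure_display) (T : measurableType d)
    (A B : set T) : measurable A -> measurable B -> measurable (A `+` B).
Proof.
by move=> mA mB; rewrite setY_def; apply: measurableU; exact: measurableD.
Qed.

Section step_set.
Context (R : realType) (d : measure_display) (T : measurableType d).

(** The fibers of [p] are the cells of a finite partition, and [q] selects the products of cells
    that make up [F]. In this encoding a complement negates [q], and a union pairs the labels of the
    two partitions. *)
Definition step_set (F : set (T * T)) : Prop :=
  exists (K : finType) (p : T -> K) (q : rel K),
    (forall a, measurable (p @^-1` [set a])) /\
    F = [set z | q (p z.1) (p z.2)].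

Lemma finite_partition_bigcup (K : finType) (p : T -> K) (q : rel K) :
  [set z : T * T | q (p z.1) (p z.2)] =
  \bigcup_(e in [set e : K * K | q e.1 e.2])
    (p @^-1` [set e.1] `*` p @^-1` [set e.2]).
Proof.
apply/seteqP; split => [[x y] /= qxy|[x y] [[a b] /= qab [/= -> ->]]//].
by exists (p x, p y).
Qed.

Lemma measurable_step_set F : step_set F -> measurable F.
Proof.
move=> [K [p [q [mp ->]]]]; rewrite (finite_partition_bigcup p q).
apply: fin_bigcup_measurable; first exact: finite_finset.
by move=> e _; exact: measurableX.
Qed.

Lemma step_setX (A B : set T) :
  measurable A -> measurable B -> step_set (A `*` B).
Proof.
move=> mA mB; exists (bool * bool)%type, (fun x => (x \in A, x \in B)).
exists (fun a b => a.1 && b.2); split.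
  have mem_meas (S : set T) b : measurable S -> measurable [set x | (x \in S) = b].
    case: b => mS; first by rewrite set_mem_set.
    rewrite [X in measurable X](_ : _ = ~` S); first exact: measurableC.
    by apply/seteqP; split => x /=; [move/negbT; rewrite notin_setE|
      move=> Sx; apply/negbTE; rewrite notin_setE].
  move=> [a b]; rewrite [X in measurable X](_ : _ =
    [set x | (x \in A) = a] `&` [set x | (x \in B) = b]).
    by apply: measurableI; exact: mem_meas.
  by apply/seteqP; split => x /= [-> ->].
apply/seteqP; split => -[x y] /=.
  by move=> [Ax By]; apply/andP; split; exact/mem_set.
by move=> /andP[/set_mem ? /set_mem ?].
Qed.

Lemma step_setC F : step_set F -> step_set (~` F).
Proof.
move=> [K [p [q [mp ->]]]]; exists K, p, (fun a b => ~~ q a b); split=> //.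
by apply/seteqP; split => z /= /negP.
Qed.

Lemma step_setU F G : step_set F -> step_set G -> step_set (F `|` G).
Proof.
move=> [K [p [q [mp ->]]]] [K' [p' [q' [mp' ->]]]].
exists (K * K')%type, (fun x => (p x, p' x)).
exists (fun a b => q a.1 b.1 || q' a.2 b.2); split.
  move=> [a b]; rewrite [X in measurable X](_ : _ =
    p @^-1` [set a] `&` p' @^-1` [set b]); first exact: measurableI.
  by apply/seteqP; split => x /= [-> ->].
by apply/seteqP; split => z /= /orP.
Qed.

Variable P : {finite_measure set (T * T)%type -> \bar R}.

Let approx (E : set (T * T)) : Prop := forall e : R, 0 < e ->
  exists F, step_set F /\ (P (E `+` F) <= e%:E)%E.

Let approxU A B : measurable A -> measurable B ->
  approx A -> approx B -> approx (A `|` B).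
Proof.
move=> mA mB aA aB e e0.
have e20 : 0 < e / 2 by rewrite divr_gt0.
have [F [sF PF]] := aA _ e20; have [G [sG PG]] := aB _ e20.
have mF := measurable_step_set sF; have mG := measurable_step_set sG.
have mYF : measurable (A `+` F) by exact: measurable_setY.
have mYG : measurable (B `+` G) by exact: measurable_setY.
exists (F `|` G); split; first exact: step_setU.
apply: (@le_trans _ _ (P ((A `+` F) `|` (B `+` G)))).
  apply: le_measure; rewrite ?inE; [|exact: measurableU|].
    by apply: measurable_setY; exact: measurableU.
  move=> z; rewrite /setY /=; tauto.
apply: (le_trans (measureU2 _ _ _)) => //.
by rewrite (splitr e) EFinD leeD.
Qed.

(** Dynkin's theorem: rectangles are step sets and form a pi-system that generates the product
    sigma-algebra. For a countable disjoint union, finiteness of [P] makes the tail cost at most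
    [e / 2], and the remaining finite union is handled by [approxU]. *)
Lemma step_set_approx (E : set (T * T)) : measurable E -> approx E.
Proof.
have stepA F : step_set F -> approx F.
  by move=> sF e e0; exists F; split=> //; rewrite setYK measure0 lee_fin ltW.
rewrite measurable_prod_measurableType => /=.
apply: (dynkin_induction (P := approx)).
- exact: measurable_prod_measurableType.
- move=> _ _ [A1 mA1 [A2 mA2 <-]] [B1 mB1 [B2 mB2 <-]].
  rewrite -setXI; exists (A1 `&` B1); first exact: measurableI.
  by exists (A2 `&` B2) => //; exact: measurableI.
- by apply: stepA; rewrite -setXTT; exact: step_setX.
- by move=> _ [A mA [B mB <-]]; apply: stepA; exact: step_setX.
- move=> S mS aS e e0; have [F [sF PF]] := aS e e0.
  exists (~` F); split; first exact: step_setC.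
  suff -> : (~` S `+` ~` F) = S `+` F by [].
  (* A complement is a symmetric difference with [setT], and the two copies of [setT] cancel. *)
  by rewrite -!setYTC -setYA (setYC F) (setYA setT) setYK set0Y.
- move=> F mF tF aF e e0; have e20 : 0 < e / 2 by rewrite divr_gt0.
  have mU : measurable (\bigcup_k F k) by exact: bigcup_measurable.
  have mUn n : measurable (\big[setU/set0]_(i < n) F i).
    exact: bigsetU_measurable.
  have aUn n : approx (\big[setU/set0]_(i < n) F i).
    elim: n => [|n IHn]; last by rewrite big_ord_recr /=; apply: approxU (mUn n) (mF n) IHn (aF n).
    rewrite big_ord0 -[set0]setCK setC0 -setXTT; apply: stepA.
    by apply: step_setC; apply: step_setX; exact: measurableT.
  pose rest n := \bigcup_i F i `\` \big[setU/set0]_(i < n) F i.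
  have [n Pn] : exists n, (P (rest n) <= (e / 2)%:E)%E.
    have := cvg_measure_tail P mF tF.
    move=> /fine_cvgP[_ /cvgr0Pnorm_lt/(_ _ e20)[n _ /(_ n (leqnn n)) /= Pn]].
    exists n; rewrite -[leLHS]fineK ?fin_num_measure//; last exact: measurableD.
    by rewrite lee_fin ltW// (le_lt_trans (ler_norm _)).
  have [G [sG PG]] := aUn n _ e20; exists G; split=> //.
  have mG := measurable_step_set sG.
  apply: (@le_trans _ _ (P (rest n `|` (\big[setU/set0]_(i < n) F i `+` G)))).
    apply: le_measure; rewrite ?inE; [exact: measurable_setY| |].
      by apply: measurableU; [exact: measurableD|exact: measurable_setY].
    have := @bigsetU_bigcup _ F n.
    move=> FU z; have := FU z; have := EM ((\big[setU/set0]_(i < n) F i) z).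
    rewrite /rest /setY /=; tauto.
  apply: (le_trans (measureU2 _ _ _)) => //; first exact: measurableD.
    exact: measurable_setY.
  by rewrite (splitr e) EFinD leeD.
Qed.

End step_set.

(** * Sampling a tuple with prescribed cells *)

Section pair_marginal.
Context (R : realType) (d : measure_display) (T : measurableType d).
Variables (nu : probability T R) (n : nat) (C : 'I_n -> set T).
Hypothesis mC : forall i, measurable (C i).

Definition box : set (n.-tuple T) := [set x | forall i, C i (tnth x i)].

Lemma measurable_box : measurable box. Proof. exact: measurable_rect. Qed.

(** Both sides are measures in [D], so agreement on rectangles is enough. Each is identified with
    [m1 \x m2], where [m1] and [m2] restrict [nu] to the cells of [v] and [w] and [m1] absorbs the
    constant factor. *)
Lemma power_prob_pair (v w : 'I_n) (D : set (T * T)) :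
  v != w -> measurable D ->
  power_prob nu n (box `&` [set x | D (tnth x v, tnth x w)]) =
  ((\prod_(i < n | (i != v) && (i != w)) nu (C i)) *
    (nu \x nu) (D `&` (C v `*` C w)))%E.
Proof.
move=> vw mD; pose pr (x : n.-tuple T) := (tnth x v, tnth x w).
have mpr : measurable_fun setT pr.
  by apply/measurable_fun_pairP; split; exact: measurable_tnth.
have k0 : 0 <= \prod_(i < n | (i != v) && (i != w)) fine (nu (C i)).
  by apply: prodr_ge0 => i _; exact: fine_ge0.
pose kappa := NngNum k0.
have kappaE : ((\prod_(i < n | (i != v) && (i != w)) nu (C i)) = kappa%:num%:E)%E.
  by rewrite -prodEFin; apply: eq_bigr => i _; rewrite fineK ?fin_num_measure.
pose m1 := mrestr (mscale kappa nu) (mC v).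
pose m2 := mrestr nu (mC w).
pose m' : {measure set (T * T)%type -> \bar R} :=
  measure_function_pushforward__canonical__measure_function_Measure
    (mrestr (power_prob nu n) measurable_box) mpr.
pose m'' : {measure set (T * T)%type -> \bar R} :=
  mscale kappa (mrestr (nu \x nu)%E (measurableX (mC v) (mC w))).
rewrite kappaE -[RHS]/(m'' D).
rewrite [LHS](_ : _ = m' D); last by rewrite /= /pushforward /mrestr setIC.
transitivity ((m1 \x m2)%E D); [apply/esym|]; apply: product_measure_unique => // A B mA mB.
  rewrite /= /pushforward /m1 /m2 /mrestr /mscale -kappaE.
  (* For a rectangle the event is again a box, with the cells of [v] and [w] cut down by [A] and
     [B], so [power_prob_rect] applies. *)
  pose C' i := if i == v then A `&` C v else if i == w then B `&` C w else C i.
  have mC' i : measurable (C' i).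
    by rewrite /C'; case: ifP => _; [|case: ifP => _]; first [exact: measurableI|exact: mC].
  rewrite [X in power_prob nu n X](_ : _ = [set x | forall i, C' i (tnth x i)]).
    rewrite power_prob_rect// (bigD1 v)//= (bigD1 w) 1?eq_sym//=.
    have -> : C' v = A `&` C v by rewrite /C' eqxx.
    have -> : C' w = B `&` C w by rewrite /C' eq_sym (negbTE vw) eqxx.
    rewrite muleA [LHS]muleC.
    rewrite -[RHS]muleA; congr (_ * _)%E; apply: eq_bigr => i /andP[iv iw].
    rewrite /C'.
    by rewrite (negbTE iv) (negbTE iw).
  apply/seteqP; split => x /=.
    move=> [[Ax Bx] Cx] i; rewrite /C'.
    by case: eqP => [->|_]; [|case: eqP => [->|_]]; [split|split|].
  move=> C'x; have := C'x v; have := C'x w.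
  rewrite /C' eqxx eq_sym (negbTE vw) eqxx => -[Bx Cw] [Ax Cv]; split => // i.
  have := C'x i; rewrite /C'.
  by case: eqP => [->//|_]; case: eqP => [->//|_].
rewrite /= /m1 /m2 /mscale /mrestr -muleA -product_measure1E; [|exact: measurableI..].
by rewrite setXI.
Qed.

End pair_marginal.
Section sampling.
Context (R : realType) (d : measure_display) (T : measurableType d).
Variables (nu : probability T R) (n : nat) (C : 'I_n -> set T).
Hypotheses (mC : forall i, measurable (C i)) (C0 : forall i, (0 < nu (C i))%E).

(** First-moment argument. The inequality between [a] and [b] says that, for a point drawn from the
    box, [a v w] times the indicator of [D] has mean at most [b v w]; hence the weighted sum has
    mean below [e]. Without a suitable sample this sum would be at least [e] almost everywhere on
    the box, which has positive measure because its sides do. *)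
Lemma exists_sample (D : set (T * T)) (Q : set (n.-tuple T))
    (a b : 'I_n -> 'I_n -> \bar R) (e : R) :
  measurable D -> {ae power_prob nu n, forall x, Q x} ->
  (forall v w, 0 <= a v w)%E ->
  (forall v w, v != w ->
    a v w * (nu \x nu) (D `&` (C v `*` C w)) <= b v w * (nu (C v) * nu (C w)))%E ->
  (forall v w, 0 <= b v w)%E ->
  (\sum_(u : 'I_n * 'I_n | u.1 != u.2) b u.1 u.2 < e%:E)%E ->
  exists x : n.-tuple T, [/\ box C x, Q x &
    (\sum_(u : 'I_n * 'I_n | u.1 != u.2)
       a u.1 u.2 * (\1_D (tnth x u.1, tnth x u.2))%:E < e%:E)%E].
Proof.
move=> mD aeQ a0 ab b0 be; apply: contrapT => /forallNP noX.
set P := power_prob nu n in aeQ *.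
pose Dx (u : 'I_n * 'I_n) := [set x : n.-tuple T | D (tnth x u.1, tnth x u.2)].
pose Phi x := (\sum_(u : 'I_n * 'I_n | u.1 != u.2)
  a u.1 u.2 * (\1_(Dx u) x)%:E)%E.
have mDx u : measurable (Dx u).
  rewrite -[Dx u]setTI.
  apply: (_ : measurable_fun setT
    (fun x : n.-tuple T => (tnth x u.1, tnth x u.2))) => //.
  by apply/measurable_fun_pairP; split; exact: measurable_tnth.
have mterm u : measurable_fun (box C) (fun x => a u.1 u.2 * (\1_(Dx u) x)%:E)%E.
  apply: measurable_funeM; apply/measurable_EFinP.
  exact: measurable_indic.
have mbox := measurable_box mC.
have Phi0 x : (0 <= Phi x)%E by apply: sume_ge0 => u _; rewrite mule_ge0// lee_fin.
have Pbox : P (box C) = (\prod_(i < n) nu (C i))%E by exact: power_prob_rect.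
have Pbox0 : (0 < P (box C))%E.
  rewrite Pbox; elim/big_ind: _ => //.
  by move=> x y x0 y0; exact: mule_gt0.
have intPhi : (\int[P]_(x in box C) Phi x =
    \sum_(u : 'I_n * 'I_n | u.1 != u.2) a u.1 u.2 * P (box C `&` Dx u))%E.
  rewrite /Phi; under eq_integral do rewrite -big_filter.
  rewrite ge0_integral_sum//; last by move=> u x _; rewrite mule_ge0// lee_fin.
  rewrite big_filter; apply: eq_bigr => u _.
  rewrite ge0_integralZl//; last exact/measurable_EFinP/measurable_indic.
  by rewrite integral_indic// setIC.
have : (\int[P]_(x in box C) Phi x < e%:E * P (box C))%E.
  rewrite intPhi; apply: (@le_lt_trans _ _
      ((\sum_(u : 'I_n * 'I_n | u.1 != u.2) b u.1 u.2) * P (box C)))%E; last first.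
    by rewrite lte_pmul2r// fin_num_measure.
  rewrite ge0_sume_distrl//; apply: lee_sum => -[v w] /= vw.
  have -> : (P (box C) = nu (C v) * nu (C w) *
      \prod_(i < n | (i != v) && (i != w)) nu (C i))%E.
    rewrite Pbox (bigD1 v)//= -muleA; congr (_ * _)%E.
    by rewrite (bigD1 w)//= eq_sym.
  rewrite power_prob_pair// muleCA [leRHS]muleA [leRHS]muleC.
  by apply: lee_wpmul2l; [exact: prode_ge0|exact: ab].
apply/negP; rewrite -leNgt -integral_cst//.
apply: ae_ge0_le_integral => //.
- by move=> x _; exact: ltW (le_lt_trans (sume_ge0 _ _) be).
- by rewrite /Phi; under eq_fun do rewrite -big_filter; exact: emeasurable_sum.
apply: filterS aeQ => x Qx Cx; rewrite leNgt; apply/negP => Phix.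
by apply: (noX x); split.
Qed.

End sampling.

(** * Approximate colorings and the measures of their color classes *)

Lemma le_product_measure (R : realType) (d : measure_display)
    (T : measurableType d) (m m' : {finite_measure set T -> \bar R}) :
  (forall A, measurable A -> (m A <= m' A)%E) ->
  forall X, measurable X -> ((m \x m) X <= (m' \x m') X)%E.
Proof.
move=> mm' X mX; rewrite /product_measure1.
apply: (@le_trans _ _ (\int[m]_x (m' \o xsection X) x)%E).
  apply: ge0_le_integral => //.
  - exact: measurable_fun_xsection.
  - exact: measurable_fun_xsection.
  - by move=> x _; apply: mm'; exact: measurable_xsection.
by apply: ge0_le_measure_integral => //; exact: measurable_fun_xsection.
Qed.

Lemma measure_fibers (R : realType) (d : measure_display)
    (T : measurableType d) (mu : {measure set T -> \bar R}) (K : finType)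
    (p : T -> K) (A : set T) :
  (forall a, measurable (p @^-1` [set a])) -> measurable A ->
  (\sum_(a : K) mu (A `&` p @^-1` [set a]) = mu A)%E.
Proof.
move=> mp mA; rewrite -big_enum/= fsbig_seq ?enum_uniq// -measure_fin_bigcup//.
- congr (mu _); apply/seteqP; split => [x [a _ []]//|x Ax].
  by exists (p x) => //=; rewrite mem_enum.
- by apply/trivIsetP => a b _ _; apply: contra_neqP => /eqP/set0P[x [[_ <-] [_ <-]]].
- by move=> a _; exact: measurableI.
Qed.

Section cell_measure.
Context (R : realType) (d : measure_display) (T : measurableType d).
Variables (mu : {measure set T -> \bar R}) (I : finType) (Q : pred I).
Variables (c : R) (B : I -> set T).

(** With [Q] selecting the vertices of one color, this is the measure of that color class: each
    vertex contributes the share [c] of its cell. The arguments [c0] and [mB] carry the facts behind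
    the measure structure declared below. *)
Definition cell_measure (c0 : 0 <= c) (mB : forall v, measurable (B v))
  (A : set T) : \bar R := (\sum_(v | Q v) c%:E * mu (A `&` B v))%E.

Hypotheses (c0 : 0 <= c) (mB : forall v, measurable (B v)).

Local Notation theta := (cell_measure c0 mB).

Let theta0 : theta set0 = 0%E.
Proof.
by rewrite /cell_measure big1// => v _; rewrite set0I measure0 mule0.
Qed.

Let theta_ge0 A : (0 <= theta A)%E.
Proof. by apply: sume_ge0 => v _; rewrite mule_ge0. Qed.

Let theta_sigma_additive : semi_sigma_additive theta.
Proof.
move=> F mF tF mUF; rewrite /cell_measure.
under eq_fun do rewrite exchange_big/=.
apply: cvg_nnesum => v _.
  by apply: nearW => n; apply: sume_ge0 => i _; rewrite mule_ge0.
have := @measure_semi_sigma_additive _ _ _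
  (mscale (NngNum c0) (mrestr mu (mB v))) F mF tF mUF.
exact.
Qed.

HB.instance Definition _ := isMeasure.Build _ _ _ theta
  theta0 theta_ge0 theta_sigma_additive.

End cell_measure.

Section finite_cell_measure.
Context (R : realType) (d : measure_display) (T : measurableType d).
Variables (mu : {finite_measure set T -> \bar R}) (I : finType) (Q : pred I).
Variables (c : R) (B : I -> set T).
Hypotheses (c0 : 0 <= c) (mB : forall v, measurable (B v)).

Let cell_measure_fin : fin_num_fun (cell_measure mu Q c0 mB).
Proof.
move=> A mA; rewrite /cell_measure sum_fin_num; apply/allP => _ /mapP[v _ ->] /=.
by rewrite fin_numM// fin_num_measure//; exact: measurableI.
Qed.

HB.instance Definition _ := Measure_isFinite.Build _ _ _
  (cell_measure mu Q c0 mB) cell_measure_fin.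

End finite_cell_measure.

(** The right-hand side is itself a cell measure, on pairs of indices with weight [c * c], and it
    factors on rectangles; uniqueness of the product measure does the rest. *)
Lemma cell_measure_prod (R : realType) (d : measure_display)
    (T : measurableType d) (nu theta : {finite_measure set T -> \bar R})
    (I : finType) (Q : pred I) (c : R) (B : I -> set T) :
  0 <= c -> (forall v, measurable (B v)) ->
  (forall A, measurable A -> theta A = \sum_(v | Q v) c%:E * nu (A `&` B v))%E ->
  forall X, measurable X -> ((theta \x theta) X =
    \sum_(u | Q u.1 && Q u.2) (c * c)%:E * (nu \x nu) (X `&` (B u.1 `*` B u.2)))%E.
Proof.
move=> c0 mB thetaE X mX.
have mB2 (u : I * I) : measurable (B u.1 `*` B u.2) by exact: measurableX.
pose m' := cell_measure (nu \x nu)%E (fun u : I * I => Q u.1 && Q u.2)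
  (mulr_ge0 c0 c0) mB2.
rewrite -[RHS]/(m' X); apply: product_measure_unique => // A A' mA mA'.
rewrite /= /m' /cell_measure !thetaE// ge0_sume_distrl; last first.
  by move=> v _; rewrite mule_ge0.
under [RHS]eq_bigr => v _.
  rewrite ge0_sume_distrr; last by move=> w _; rewrite mule_ge0.
  over.
rewrite pair_big/=; apply: eq_bigr => u _.
by rewrite -setXI product_measure1E ?EFinM 1?muleACA//; exact: measurableI.
Qed.

(** The map [h] takes each value exactly [M] times, which is expressed as a summation rule. It will
    place [M] sample vertices in each cell. *)
Lemma balanced_indexing (R : realType) (K : finType) (M : nat) :
  exists (N : nat) (h : 'I_N -> K), forall f : K -> \bar R,
    (\sum_(v < N) f (h v) = \sum_(a : K) \sum_(s < M) f a)%E.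
Proof.
exists #|{: K * 'I_M}|, (fun v => (enum_val v).1) => f.
rewrite pair_big/= (reindex (@enum_val _ {: K * 'I_M}))//=.
exact: onW_bij (enum_val_bij _).
Qed.

Lemma sume_diag (R : realType) (I : finType) (f : I -> I -> \bar R) :
  (\sum_(u : I * I | u.1 == u.2) f u.1 u.2 = \sum_(v : I) f v v)%E.
Proof.
rewrite -(pair_big_dep xpredT (fun v w => v == w))/=.
by apply: eq_bigr => v _; under eq_bigl do rewrite eq_sym; rewrite big_pred1_eq.
Qed.

(** Each cell is shared equally among its [M] sample vertices, and [theta i] collects the shares of
    the vertices colored [i]. Two distinct vertices of the same color are not joined in [E]; if
    their cells are joined in [F], their sample points witness a disagreement between [E] and [F],
    and the sample was chosen to have few of these. *)
Lemma approximate_coloring (R : realType) (d : measure_display)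
    (T : measurableType d) (nu : probability T R) (k : nat) (W : T * T -> R)
    (hW : is_graphon W) (e : R) :
  (forall m, {ae power_prob nu m, forall x, colorable (sample_graph hW x) k}) ->
  0 < e ->
  exists theta : 'I_k -> {finite_measure set T -> \bar R},
    (forall A, measurable A -> \sum_(i < k) theta i A = nu A)%E /\
    (forall i, (theta i \x theta i) [set z | W z != 0%R] <= e%:E)%E.
Proof.
move=> hcol e0; pose E := [set z | W z != 0]; have [mW _ _] := hW.
have mE : measurable E by exact: measurable_support.
(* The error [e] splits into [e / 4] for the mass of [D], [e / 4] for vertices paired with
   themselves, and [e / 2] for disagreements in the sample. *)
have e4 : 0 < e / 4 by rewrite divr_gt0.
pose nu2 : probability (T * T)%type R := (nu \x nu)%E.
have [F [sF PF]] := step_set_approx nu2 mE e4.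
have mF := measurable_step_set sF.
have {}PF : ((nu \x nu) (E `+` F) <= (e / 4)%:E)%E by [].
set D := E `+` F in PF; have mD : measurable D by exact: measurable_setY.
have [K [p [q [mp Fq]]]] := sF.
(* The coloring says nothing about a vertex paired with itself; such pairs have total mass at most
   [c = 1 / M], whence the choice of [M]. *)
pose M := (Num.truncn (e / 4)^-1).+1; pose c : R := M%:R^-1.
have c0 : 0 <= c by rewrite invr_ge0.
have ce : c <= e / 4.
  by rewrite invf_ple ?posrE// ltW// truncnS_gt.
have [N [h hP]] := balanced_indexing R K M.
pose B (v : 'I_N) := p @^-1` [set h v].
have mB v : measurable (B v) by exact: mp.
have nuB A : measurable A -> (\sum_(v < N) c%:E * nu (A `&` B v) = nu A)%E.
  move=> mA; rewrite (hP (fun a => c%:E * nu (A `&` p @^-1` [set a]))%E).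
  rewrite -[RHS](measure_fibers nu mp mA); apply: eq_bigr => a _.
  rewrite -ge0_sume_distrl; last by move=> s _; rewrite lee_fin.
  by rewrite sumEFin sumr_const card_ord -mulr_natl /c mulfV ?pnatr_eq0// mul1e.
have nu2B X : measurable X -> (\sum_(u : 'I_N * 'I_N)
    (c * c)%:E * (nu \x nu) (X `&` (B u.1 `*` B u.2)) = (nu \x nu) X)%E.
  move=> mX; rewrite (@cell_measure_prod _ _ _ nu nu _ xpredT c B)//.
  by move=> A mA; rewrite nuB.
pose om v := (c%:E * nu (B v))%E.
have om0 v : (0 <= om v)%E by rewrite mule_ge0.
(* The weight [om] of a null cell is 0, so its sample point may lie anywhere;
   enlarging such cells keeps the sampling box from being null. *)
pose C v := if nu (B v) == 0%E then setT else B v.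
have mC v : measurable (C v) by rewrite /C; case: ifP.
have C0 v : (0 < nu (C v))%E.
  rewrite /C; case: ifPn => [_|]; first by rewrite probability_setT lte01.
  by rewrite measure_gt0.
(* For non-null cells this is the mean of [om v * om w] times the indicator of [D]. Over all pairs
   these sum to the measure of [D], at most [e / 4], which leaves room for the strict bound
   [e / 2]. *)
pose b v w := ((c * c)%:E * (nu \x nu) (D `&` (B v `*` B w)))%E.
have [||||x [Cx /colorableP[col colP] Phix]] :=
  @exists_sample _ _ _ nu N C mC C0 D _ (fun v w => om v * om w)%E b (e / 2)
    mD (hcol N).
- by move=> v w; rewrite mule_ge0.
- move=> v w _; rewrite /b /C /om.
  have [->|Bv] := eqVneq (nu (B v)) 0%E.
    by rewrite mule0 !mul0e !mule_ge0 ?lee_fin ?mulr_ge0.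
  have [->|Bw] := eqVneq (nu (B w)) 0%E.
    by rewrite mule0 mule0 !mul0e !mule_ge0 ?lee_fin ?mulr_ge0.
  by rewrite muleACA EFinM [leLHS]muleAC.
- by move=> v w; rewrite mule_ge0// lee_fin mulr_ge0.
- apply: (@le_lt_trans _ _ (e / 4)%:E); last by rewrite lte_fin; lra.
  apply: le_trans PF; rewrite -nu2B//.
  apply: lee_sum_nneg_subset => // u _.
  by rewrite mule_ge0// lee_fin mulr_ge0.
pose theta i : {finite_measure set T -> \bar R} :=
  cell_measure nu (fun v => col v == i) c0 mB.
have theta2E i X : measurable X -> ((theta i \x theta i) X =
    \sum_(u | (col u.1 == i) && (col u.2 == i))
      (c * c)%:E * (nu \x nu) (X `&` (B u.1 `*` B u.2)))%E.
  by move=> mX; rewrite (@cell_measure_prod _ _ _ nu (theta i) _ (fun v => col v == i) c B).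
exists theta; split => [A mA|i].
  by rewrite -nuB// (partition_big col xpredT).
have thetaD : ((theta i \x theta i) D <= (e / 4)%:E)%E.
  apply: le_trans PF; rewrite -nu2B// theta2E//.
  apply: lee_sum_nneg_subset => // u _.
  by rewrite mule_ge0// lee_fin mulr_ge0.
pose G (u : 'I_N * 'I_N) :=
  ((c * c)%:E * (nu \x nu) (F `&` (B u.1 `*` B u.2)))%E.
have G0 u : (0 <= G u)%E by rewrite mule_ge0// lee_fin mulr_ge0.
have Gom u : (G u <= om u.1 * om u.2)%E.
  rewrite /om muleACA /G EFinM -product_measure1E//.
  apply: lee_wpmul2l; first by rewrite mule_ge0.
  by apply: le_measure; rewrite ?inE//=; [apply: measurableI => //|]; exact: measurableX.
(* Each [om v] is at most [c], and these weights sum to 1. *)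
have Gdiag : (\sum_(u : 'I_N * 'I_N | u.1 == u.2) om u.1 * om u.2 <= (e / 4)%:E)%E.
  rewrite (sume_diag (fun v w => om v * om w)%E).
  apply: (@le_trans _ _ (c%:E * nu setT)%E); last by rewrite probability_setT mule1 lee_fin.
  rewrite -(nuB setT)// ge0_sume_distrr; last by move=> v _; rewrite mule_ge0.
  apply: lee_sum => v _; rewrite setTI; apply: lee_wpmul2r => //.
  rewrite -[leRHS]mule1; apply: lee_wpmul2l => //.
  exact: probability_le1.
(* Null cells carry no mass, and neither does a pair of cells outside [F]. Otherwise the sample pair
   lies in [F], while properness of [col] keeps it out of [E]; so it lies in [D]. *)
have Goff u : u.1 != u.2 -> (col u.1 == i) && (col u.2 == i) ->
    (G u <= om u.1 * om u.2 * (\1_D (tnth x u.1, tnth x u.2))%:E)%E.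
  move=> vw /andP[/eqP ci /eqP cj].
  have [B0|B1] := eqVneq (nu (B u.1)) 0%E.
    by apply: (le_trans (Gom u)); rewrite /om B0 mule0 !mul0e.
  have [B0|B2] := eqVneq (nu (B u.2)) 0%E.
    by apply: (le_trans (Gom u)); rewrite /om B0 !mule0 mul0e.
  have x1 : B u.1 (tnth x u.1) by have := Cx u.1; rewrite /C (negbTE B1).
  have x2 : B u.2 (tnth x u.2) by have := Cx u.2; rewrite /C (negbTE B2).
  have [Qu|Qu] := boolP (q (h u.1) (h u.2)); last first.
    rewrite /G [X in (nu \x nu)%E X](_ : _ = set0).
      by rewrite measure0 mule0 !mule_ge0// lee_fin.
    apply/seteqP; split => // -[y z]; rewrite Fq /B /= => -[+ [yh zh]].
    by rewrite yh zh (negbTE Qu).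
  apply: (le_trans (Gom u)); rewrite indicE mem_set ?mule1//; right.
  split; first by rewrite Fq /= x1 x2.
  move=> /= Wx; have /colP : adj (sample_graph hW x) u.1 u.2.
    by rewrite /= /sample_adj vw.
  by rewrite ci cj eqxx.
have thetaF : ((theta i \x theta i) F <= (e / 4)%:E + (e / 2)%:E)%E.
  rewrite theta2E// (bigID (fun u => u.1 == u.2))/=; apply: leeD.
    apply: le_trans Gdiag.
    apply: (@le_trans _ _ (\sum_(u | [&& col u.1 == i, col u.2 == i & u.1 == u.2]) om u.1 * om u.2)%E).
      rewrite -(eq_bigl _ _ (fun u => andbA _ _ _)).
      by apply: lee_sum => u _; exact: Gom.
    apply: lee_sum_nneg_subset => [u|u _]; last by rewrite mule_ge0.
    by case/and3P.
  apply: ltW; apply: le_lt_trans Phix.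
  apply: (@le_trans _ _ (\sum_(u : 'I_N * 'I_N | (col u.1 == i) && (col u.2 == i) && (u.1 != u.2))
       om u.1 * om u.2 * (\1_D (tnth x u.1, tnth x u.2))%:E)%E).
    by apply: lee_sum => u /andP[cc uu]; exact: Goff.
  apply: lee_sum_nneg_subset => [u|u _]; last by rewrite !mule_ge0// lee_fin.
  by case/andP.
apply: (@le_trans _ _ ((theta i \x theta i) (F `|` D))%E).
  apply: le_measure; rewrite ?inE//; first exact: measurableU.
  by move=> z Ez; have [Fz|nFz] := EM (F z); [left|right; left].
apply: (le_trans (measureU2 _ _ _)) => //.
apply: (le_trans (leeD thetaF thetaD)).
by rewrite -!EFinD lee_fin; lra.
Qed.

(** * Limits of dominated measures along an ultrafilter *)

Lemma ultra_cvg_segment (R : realType) (I : Type) (U : set_system I)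
    (v : I -> R) (M : R) :
  UltraFilter U -> (forall n, 0 <= v n <= M) -> cvg (v @ U).
Proof.
move=> UU v0M.
have vM : U (v @^-1` [set` `[0, M]]) by apply: filterE => n /=; rewrite in_itv /= v0M.
have [p [_ clp]] := @segment_compact R 0 M (v @ U) _ vM.
apply/cvg_ex; exists p => B pB.
(* A cluster point of an ultrafilter is a limit: otherwise the values would lie [U]-often outside
   the neighborhood [B], which the cluster point forbids. *)
have [//|UB] := in_ultra_setVsetC (v @^-1` B) UU.
by have [x [nBx Bx]] := clp (~` B) B UB pB.
Qed.

Section ultralimit_measure.
Context (R : realType) (d : measure_display) (T : measurableType d).
Variables (I : Type) (U : set_system I) (UU : UltraFilter U).
Variables (P : {finite_measure set T -> \bar R}).
Variable theta : I -> {measure set T -> \bar R}.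
Hypothesis theta_le : forall n A, measurable A -> (theta n A <= P A)%E.

(* Truncating at [P setT] makes the limit exist also for non-measurable [A]. *)
Let clip A (n : I) : R := Num.min (fine (theta n A)) (fine (P setT)).

Definition ultralimit (A : set T) : \bar R := (lim (clip A @ U))%:E.

Let clip_cvg A : cvg (clip A @ U).
Proof.
apply: (@ultra_cvg_segment _ _ _ _ (fine (P setT))) => n.
by rewrite /clip ge_min lexx orbT andbT le_min !fine_ge0.
Qed.

Let theta_fin n A : measurable A -> theta n A \is a fin_num.
Proof.
move=> mA; rewrite ge0_fin_numE//.
by rewrite (le_lt_trans (theta_le n mA))// -ge0_fin_numE// fin_num_measure.
Qed.

Let clipE A n : measurable A -> clip A n = fine (theta n A).
Proof.
move=> mA; rewrite /clip; apply/min_idPl.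
rewrite fine_le ?theta_fin ?fin_num_measure//.
by rewrite (le_trans (theta_le n mA))// le_measure ?inE.
Qed.

Let cvg_ultralimit A : measurable A ->
  theta n A @[n --> U] --> ultralimit A.
Proof.
move=> mA; have -> : (fun n => theta n A) = EFin \o clip A.
  by apply/funext => n; rewrite /= clipE// fineK// theta_fin.
by apply: cvg_EFin; [exact: nearW|exact: clip_cvg].
Qed.

Let ultralimit_le A : measurable A -> (ultralimit A <= P A)%E.
Proof.
move=> mA; rewrite -(@fineK _ (P A)) ?fin_num_measure// lee_fin.
apply: limr_le; first exact: clip_cvg.
apply: filterE => n; rewrite clipE//.
by rewrite fine_le ?theta_fin ?fin_num_measure// theta_le.
Qed.

Let ultralimit_ge0 A : (0 <= ultralimit A)%E.
Proof.
rewrite lee_fin; apply: limr_ge; first exact: clip_cvg.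
by apply: filterE => n; rewrite /clip le_min !fine_ge0.
Qed.

Let ultralimit0 : ultralimit set0 = 0%E.
Proof.
by apply/eqP; rewrite eq_le ultralimit_ge0 -(measure0 P) ultralimit_le.
Qed.

Let ultralimit_additive : measure_function.semi_additive ultralimit.
Proof.
apply/additive2P => // A B mA mB AB0.
have mAB : measurable (A `|` B) by exact: measurableU.
rewrite /ultralimit -EFinD; congr EFin.
have <- := cvg_lim _ (cvgD (clip_cvg (A := A)) (clip_cvg (A := B))) => //.
congr (lim (_ @ U)); apply/funext => n /=.
by rewrite clipE// measureU// fineD ?theta_fin// -!clipE.
Qed.

HB.instance Definition _ := isContent.Build _ _ _ ultralimit
  ultralimit_ge0 ultralimit_additive.

(** Domination upgrades finite to countable additivity: the partial sums miss the whole by the limit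
    measure of the tail, which is at most its [P]-measure and so tends to 0. *)
Let ultralimit_sigma_additive : semi_sigma_additive ultralimit.
Proof.
move=> F mF tF mUF; pose rest n := \bigcup_i F i `\` \big[setU/set0]_(i < n) F i.
have mF_ n : measurable (\big[setU/set0]_(i < n) F i).
  exact: bigsetU_measurable.
have mrest n : measurable (rest n) by exact: measurableD.
have sub n : \big[setU/set0]_(i < n) F i `<=` \bigcup_i F i.
  exact: bigsetU_bigcup.
have sumE (Q : {content set T -> \bar R}) n :
    (Q (\bigcup_i F i) = \sum_(0 <= i < n) Q (F i) + Q (rest n))%E.
  rewrite big_mkord -measure_bigsetU// -measureU//; first by rewrite setDUK.
  by rewrite setDIK.
have Prest0 : P (rest n) @[n --> \oo] --> 0%E by exact: cvg_measure_tail.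
have fu A : ultralimit A \is a fin_num by [].
apply: (@squeeze_cvge _ _ _ _ (fun n => ultralimit (\bigcup_i F i) - P (rest n))%E _
  (fun=> ultralimit (\bigcup_i F i))).
- apply: nearW => n; rewrite leeBlDr ?fin_num_measure// (sumE _ n).
  rewrite leeD2l ?ultralimit_le//=.
  by rewrite leeDl.
- rewrite -[X in _ --> X]sube0; apply: cvgeB => //; last exact: cvg_cst.
- exact: cvg_cst.
Qed.

HB.instance Definition _ := Content_isMeasure.Build _ _ _ ultralimit
  ultralimit_sigma_additive.

Let ultralimit_fin : fin_num_fun ultralimit. Proof. by []. Qed.

HB.instance Definition _ := Measure_isFinite.Build _ _ _ ultralimit
  ultralimit_fin.

Lemma exists_ultralimit : exists mu : {finite_measure set T -> \bar R},
  forall A, measurable A ->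
    theta n A @[n --> U] --> mu A /\ (mu A <= P A)%E.
Proof.
exists ultralimit => A mA.
by split; [exact: cvg_ultralimit|exact: ultralimit_le].
Qed.

End ultralimit_measure.

(** * Supports of dominated measures *)

Section support.
Context (R : realType) (d : measure_display) (T : measurableType d).
Variables nu mu : {finite_measure set T -> \bar R}.

(** [S] is where the Radon-Nikodym density of [mu] is non-zero. On a [mu]-null set the density
    integrates to 0, hence vanishes [nu]-almost everywhere there. Thus [nu] restricted to [S] is
    absolutely continuous with respect to [mu]. *)
Lemma exists_support : (forall A, measurable A -> (mu A <= nu A)%E) ->
  exists S, [/\ measurable S, mu (~` S) = 0%E &
    forall B, measurable B -> mu B = 0%E -> nu (B `&` S) = 0%E].
Proof.
move=> mu_nu.
have [|f [f0 ffin intf muE]] := @radon_nikodym_sigma_finite _ _ _ nu mu.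
  apply/null_content_dominatesP => A mA nuA0; apply/eqP.
  by rewrite eq_le measure_ge0 andbT -nuA0 mu_nu.
have mf := measurable_int _ intf.
have mS : measurable [set x | f x != 0%E].
  by rewrite -[X in measurable X]setTI; exact: emeasurable_neq.
exists [set x | f x != 0%E]; split => // [|B mB muB0].
  rewrite muE; last exact: measurableC.
  by apply: integral0_eq => x /= /negP/negPn/eqP.
have : ae_eq nu B f (cst 0%E).
  apply/ae_eq_integral_abs => //; first exact: measurable_funTS.
  by rewrite -[RHS]muB0 muE//; apply: eq_integral => x _; rewrite gee0_abs.
move=> fB0; apply/(measure_negligible (measurableI _ _ mB mS)).
by apply: negligibleS fB0 => x /= [Bx fx0] /(_ Bx) /eqP; exact/negP.
Qed.

(** Absolute continuity on [S] is used once per coordinate. The set [Z] of points whose section of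
    [E] is not [mu]-null is [mu]-null, so it meets [S] in a [nu]-null set; the other sections meet
    [S] in [nu]-null sets. *)
Lemma product_support (E : set (T * T)) (S : set T) :
  measurable E -> measurable S -> (mu \x mu)%E E = 0%E ->
  (forall B, measurable B -> mu B = 0%E -> nu (B `&` S) = 0%E) ->
  (nu \x nu)%E (E `&` (S `*` S)) = 0%E.
Proof.
move=> mE mS muE0 muS.
have mphi : measurable_fun setT (mu \o xsection E) by exact: measurable_fun_xsection.
have : ae_eq mu setT (mu \o xsection E) (cst 0%E).
  apply/ae_eq_integral_abs => //.
  by rewrite -[RHS]muE0; apply: eq_integral => x _; rewrite gee0_abs.
pose Z := [set x | mu (xsection E x) != 0%E].
have mZ : measurable Z.
  by rewrite -[X in measurable X]setTI; exact: emeasurable_neq.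
move=> Z0; have muZ0 : mu Z = 0%E.
  by apply/(measure_negligible mZ); apply: negligibleS Z0 => x /= /eqP; tauto.
have mES : measurable (E `&` (S `*` S)).
  by apply: measurableI => //; exact: measurableX.
have : ae_eq nu setT (nu \o xsection (E `&` (S `*` S))) (cst 0%E).
  exists (Z `&` S); split; [exact: measurableI|exact: muS|].
  move=> x /= /not_implyP[_ nux]; apply: contrapT => nZS; apply: nux.
  have [Sx|nSx] := pselect (S x); last first.
    rewrite (_ : xsection _ _ = set0) ?measure0//.
    by apply/seteqP; split => // y; rewrite /xsection /= inE => -[_ []].
  have mux : mu (xsection E x) = 0%E.
    by apply/eqP/negPn/negP => Zx; apply: nZS.
  rewrite (_ : xsection _ _ = xsection E x `&` S).
    by apply: muS mux; exact: measurable_xsection.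
  apply/seteqP; split => y; rewrite /xsection /= !inE /=; tauto.
move/(ae_eq_integral_abs _ _ _).2 => <-//.
- by apply: eq_integral => x _; rewrite gee0_abs.
- exact: measurable_fun_xsection.
Qed.

End support.

(** * Passage to the limit of the approximate colorings *)

Section limit_coloring.
Context (R : realType) (d : measure_display) (T : measurableType d).
Variables (nu : probability T R) (k : nat) (E : set (T * T)).
Hypothesis mE : measurable E.

Lemma limit_coloring :
  (forall e : R, 0 < e ->
    exists theta : 'I_k -> {finite_measure set T -> \bar R},
      (forall A, measurable A -> \sum_(i < k) theta i A = nu A)%E /\
      (forall i, (theta i \x theta i) E <= e%:E)%E) ->
  exists mu : 'I_k -> {finite_measure set T -> \bar R},
    [/\ forall i A, measurable A -> (mu i A <= nu A)%E,
      forall A, measurable A -> (\sum_(i < k) mu i A = nu A)%E &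
      forall i, (mu i \x mu i)%E E = 0%E].
Proof.
move=> approx.
have inv0 (n : nat) : 0 < n.+1%:R^-1 :> R by rewrite invr_gt0.
have /choice[theta thetaP] (n : nat) := approx _ (inv0 n).
(* Since [U] refines the eventual filter, the errors [1 / (n + 1)] still tend to 0 along it. *)
have [U [UU Uoo]] := ultraFilterLemma eventually_filter.
have theta_le n i A : measurable A -> (theta n i A <= nu A)%E.
  move=> mA; have [<- // _] := thetaP n; rewrite (bigD1 i)//= leeDl//.
  exact: sume_ge0.
have /choice[mu muP] (i : 'I_k) :=
  exists_ultralimit UU (fun n => theta_le n i).
exists mu; split => [i A mA|A mA|i]; first by have [] := muP i A mA.
  have cv : (\sum_(i < k) theta n i A)%E @[n --> U] --> (\sum_(i < k) mu i A)%E.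
    apply: cvg_nnesum => i _; first exact: nearW.
    by have [] := muP i A mA.
  apply/esym/(cvg_unique _ _ cv) => //=.
  rewrite (_ : (fun n => _) = cst (nu A)); first exact: cvg_cst.
  by apply/funext => n; have [-> //] := thetaP n.
pose nu2 : probability (T * T)%type R := (nu \x nu)%E.
have theta2_le n X : measurable X -> ((theta n i \x theta n i) X <= nu2 X)%E.
  move=> mX; apply: le_product_measure => // A mA; exact: theta_le.
(* The limit of the product measures is taken separately on [T * T]. Being a measure, it is
   determined by rectangles, where the limit of the products is the product of the limits. *)
have [lam lamP] := exists_ultralimit UU theta2_le.
have -> : (mu i \x mu i)%E E = lam E.
  apply: product_measure_unique => // A B mA mB.
  have [cvAB _] := lamP _ (measurableX mA mB).
  have [cvA _] := muP i A mA; have [cvB _] := muP i B mB.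
  apply: (cvg_unique _ cvAB) => //=.
  under eq_fun do rewrite product_measure1E//.
  by apply: cvgeM => //; rewrite mule_def_fin ?fin_num_measure.
have [cvE _] := lamP E mE; apply: (cvg_unique _ cvE) => //=.
apply: (@squeeze_cvge _ _ _ _ (cst 0%E) _ (fun n => n.+1%:R^-1%:E)).
- by apply: nearW => n; rewrite measure_ge0/=; have [_ ->] := thetaP n.
- exact: cvg_cst.
- have h : (harmonic n : R)%:E @[n --> \oo] --> 0%E.
    by apply: cvg_EFin; [exact: nearW|exact: cvg_harmonic].
  by apply: cvg_trans h => B; exact: Uoo.
Qed.

End limit_coloring.

(** * The partition into independent sets *)

Lemma measurable_cover_partition (d : measure_display) (T : measurableType d)
    (k : nat) (A : 'I_k -> set T) :
  (forall i, measurable (A i)) -> \bigcup_i A i = setT ->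
  exists P : 'I_k -> set T, [/\ trivIset setT P, \bigcup_i P i = setT,
    forall i, measurable (P i) & forall i, P i `<=` A i].
Proof.
move=> mA cA; exists (fun i => A i `\` \bigcup_(j in [set j : 'I_k | (j < i)%N]) A j).
split.
- apply/trivIsetP => i j _ _ ij.
  move: ij; rewrite -val_eqE neq_ltn.
  wlog lt_ij : i j / (i < j)%N => [wl ij|_].
    by case/orP: (ij) => [lt|lt]; [|rewrite setIC]; apply: wl; rewrite ?lt ?orbT.
  apply/seteqP; split => // x [[Ai _] [_ nAj]]; apply: nAj.
  by exists i.
- apply/seteqP; split => // x _.
  have [i0 _ Ai0] : (\bigcup_i A i) x by rewrite cA.
  have Ai0b : `[< A i0 x >] by apply/asboolP.
  case: (@arg_minnP _ i0 (fun i => `[< A i x >]) val Ai0b) => i /asboolP Ai mini.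
  exists i => //; split => // -[j /= ji Aj].
  by have := mini j (asboolT Aj); rewrite leqNgt ji.
- move=> i; apply: measurableD => //; apply: fin_bigcup_measurable => //.
- by move=> i x [].
Qed.

Theorem proposition5 (R : realType) (d : measure_display)
    (Omega : measurableType d) (nu : probability Omega R)
    (hOmega : standard_borel R Omega) (hnu : atomless nu)
    (k : nat) (hk : (1 <= k)%N)
    (W : Omega * Omega -> R) (hW : is_graphon W)
    (hH : forall (m : nat) (H : simple_graph m),
      chromatic_number H = k.+1 -> density nu H W = 0%E) :
  partite nu k W.
Proof.
pose E := [set z | W z != 0]; have [mW _ _] := hW.
have mE : measurable E by exact: measurable_support.
have [mu [mu_le mu_sum muE]] : exists mu : 'I_k -> {finite_measure set Omega -> \bar R},
    [/\ forall i A, measurable A -> (mu i A <= nu A)%E,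
      forall A, measurable A -> (\sum_(i < k) mu i A = nu A)%E &
      forall i, (mu i \x mu i)%E E = 0%E].
  apply: limit_coloring => // e e0; apply: (approximate_coloring (hW := hW)) => // m.
  exact: ae_sample_colorable.
have /choice[S SP] (i : 'I_k) := exists_support (mu_le i).
have mS i : measurable (S i) by have [] := SP i.
(* Every [mu i] vanishes off [S i], hence on [N]; as the [mu i] sum to [nu], the set [N] is
   [nu]-null. *)
pose N := ~` (\bigcup_i S i).
have mN : measurable N.
  by apply/measurableC/fin_bigcup_measurable => //; exact: finite_finset.
have nuN : nu N = 0%E.
  rewrite -mu_sum// big1// => i _; have [_ muS _] := SP i.
  apply: subset_measure0 muS => //; first exact: measurableC.
  by apply: subsetC => x Sx; exists i.
(* Adding the null set [N] makes the sets cover [Omega], some index existing because [1 <= k].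
   Independence survives, as only the null strips [N * Omega] and [Omega * N] are affected. *)
pose A i := S i `|` N.
have mA i : measurable (A i) by exact: measurableU.
have cA : \bigcup_i A i = setT.
  apply/seteqP; split => // x _.
  have [[i _ Sx]|Nx] := EM ((\bigcup_i S i) x); first by exists i => //; left.
  by exists (Ordinal hk) => //; right.
have [P [tP cP mP PA]] := measurable_cover_partition mA cA.
exists P; split => // i; split => //.
have NT0 : (nu \x nu)%E (N `*` setT) = 0%E.
  by rewrite product_measure1E//= nuN mul0e.
have TN0 : (nu \x nu)%E (setT `*` N) = 0%E.
  by rewrite product_measure1E//= nuN mule0.
have [_ _ nuS] := SP i.
have ES0 := product_support mE (mS i) (muE i) nuS.
have mES : measurable (E `&` (S i `*` S i)).
  by apply: measurableI => //; exact: measurableX.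
have mNT : measurable (N `*` [set: Omega]) by exact: measurableX.
have mTN : measurable ([set: Omega] `*` N) by exact: measurableX.
have mU := measurableU _ _ mES mNT.
exists ((E `&` (S i `*` S i)) `|` (N `*` setT) `|` (setT `*` N)); split.
- exact: measurableU.
- by rewrite (measureU0 mU mTN TN0) (measureU0 mES mNT NT0).
move=> [x y] /= /not_implyP[[/PA Px /PA Py] /eqP Wxy].
by case: Px => [Sx|Nx]; [case: Py => [Sy|Ny]|]; [left; left|right|left; right].
Qed.
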